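(* Let $m\ge 2$ and $n\ge 1$ be integers. The determining number of the Hamming graph $K_m^{\Box n}$ (the Cartesian product of $n$ copies of the complete graph $K_m$) is the smallest integer $r$ for which $n\le S(r,m)+S(r,m-1)$.
   Context: $S(r,m)$ denotes the Stirling number of the second kind, the number of partitions of $[r]=\{1,\dots,r\}$ into $m$ nonempty unlabeled parts. A set $S$ of vertices of a graph $G$ is a determining set if the only automorphism of $G$ fixing every vertex of $S$ is the identity; the determining number $\det(G)$ is the minimum size of a determining set. *)

(* Defs.v *)
From HB Require Import structures.
From mathcomp Require Import all_boot all_order all_fingroup.

Set Implicit Arguments.
Unset Strict Implicit.
Unset Printing Implicit Defensive.

Definition stirling2 (r m : nat) : nat :=
  #|[set P : {set {set 'I_r}} | partition P [set: 'I_r] & #|P| == m]|.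

Record sgraph := SGraph {
  svertex :> finType;
  sedge : rel svertex;
  sedge_sym : symmetric sedge;
  sedge_irr : irreflexive sedge }.

Section Complete.
Variable m : nat.

Definition complete_edge : rel 'I_m := fun x y => x != y.

Lemma complete_sym : symmetric complete_edge.
Proof. by move=> x y; rewrite /complete_edge eq_sym. Qed.

Lemma complete_irr : irreflexive complete_edge.
Proof. by move=> x; rewrite /complete_edge eqxx. Qed.

Definition complete_graph := SGraph complete_sym complete_irr.
End Complete.

Section CartesianPower.
Variables (G : sgraph) (n : nat).

Definition cart_edge : rel {ffun 'I_n -> svertex G} := fun x y =>
  [exists i, sedge (x i) (y i) && [forall j, (j != i) ==> (x j == y j)]].

Lemma cart_sym : symmetric cart_edge.
Proof.
move=> x y; apply: eq_existsb => i; rewrite sedge_sym; congr (_ && _).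
by apply: eq_forallb => j; rewrite eq_sym [y j == _]eq_sym.
Qed.

Lemma cart_irr : irreflexive cart_edge.
Proof. by move=> x; apply/existsP => -[i]; rewrite sedge_irr. Qed.

Definition cart_power := SGraph cart_sym cart_irr.
End CartesianPower.

Definition hamming_graph (m n : nat) : sgraph := cart_power (complete_graph m) n.

Definition automorphism (G : sgraph) (p : {perm G}) : bool :=
  [forall x : G, forall y : G, sedge (p x) (p y) == sedge x y].

Definition determining (G : sgraph) (S : {set G}) : bool :=
  [forall p : {perm G},
     automorphism p ==> [forall x in S, p x == x] ==> (p == 1%g)].

Lemma determining_setT (G : sgraph) : determining [set: G].
Proof.
apply/forallP => p; apply/implyP => _; apply/implyP => /forall_inP fixp.
by apply/eqP/permP => x; rewrite perm1; apply/eqP/fixp; rewrite inE.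
Qed.

(* The seed [set: G] of the minimum is determining, by determining_setT. *)
Definition determining_number (G : sgraph) : nat :=
  #|[arg min_(S < [set: G] | determining S) #|S| ]|.

Lemma determining_numberP (G : sgraph) :
  (exists2 S : {set G}, determining S & #|S| = determining_number G) /\
  (forall S : {set G}, determining S -> determining_number G <= #|S|).
Proof.
rewrite /determining_number; case: arg_minnP => [|S dS minS].
  exact: determining_setT.
by split; first exists S.
Qed.

(* Main.v *)
Require Import Defs.
From mathcomp Require Import all_boot all_order all_fingroup.
From mathcomp Require Import zify.

(** Graph distance in the Hamming graph is the Hamming distance, and for
    adjacent [x], [y] that differ at coordinate [i], the vertices closer to [x]
    than to [y] are exactly those [z] with [z i = x i]. Automorphisms are
    isometries, so they permute these coordinate slices; hence every
    automorphism permutes the coordinates and relabels the values in each of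
    them. List the vertices of a set [S] as the rows of an array: each column
    partitions [S] into its level sets. The set [S] is determining iff
    the columns have pairwise distinct partitions (otherwise two coordinates
    can be exchanged) and each takes at least [m - 1] values (otherwise two
    missing values can be exchanged). Such arrays with [r] rows and [n]
    columns exist iff [n <= S(r, m) + S(r, m - 1)]. *)

Set Implicit Arguments.
Unset Strict Implicit.
Unset Printing Implicit Defensive.

(** * Level sets and partitions *)

(** Both images are in bijection with the same family of level sets. *)
Lemma card_imset_same_kernel (T U V : finType)
    (f : T -> U) (g : T -> V) :
  (forall x y, (f x == f y) = (g x == g y)) ->
  #|f @: [set: T]| = #|g @: [set: T]|.
Proof.
move=> fg.
have levels (W : finType) (h : T -> W) :
    #|h @: [set: T]| = #|[set [set y | h y == h x] | x in [set: T]]|.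
  have -> : [set [set y | h y == h x] | x in [set: T]]
            = [set [set y | h y == w] | w in h @: [set: T]].
    by rewrite -imset_comp; apply: eq_imset.
  rewrite [RHS]card_in_imset // => w w' /imsetP[x _ ->] _ /setP/(_ x).
  by rewrite !inE eqxx => /esym/eqP.
rewrite (levels _ f) (levels _ g); congr #|pred_of_set _|; apply: eq_imset => x.
by apply/setP => y; rewrite !inE fg.
Qed.

Section Kernel.
Variables (T U : finType) (f : T -> U).

Definition kernel_partition : {set {set T}} := preim_partition f [set: T].

Lemma kernel_partitionP : partition kernel_partition [set: T].
Proof. exact: preim_partitionP. Qed.

Lemma pblock_kernel_partition x y :
  (pblock kernel_partition x == pblock kernel_partition y) = (f x == f y).
Proof.
rewrite eq_pblock; first last.
- by case/and3P: kernel_partitionP => /eqP -> _ _; rewrite inE.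
- by case/and3P: kernel_partitionP.
by rewrite pblock_equivalence_partition ?inE // => u v w _ _ _;
  split=> // /eqP ->.
Qed.
End Kernel.

Lemma imset_pblock (T : finType) (P : {set {set T}}) :
  partition P [set: T] -> pblock P @: [set: T] = P.
Proof.
case/and3P=> /eqP cP tP nP; apply/setP => B; apply/imsetP/idP => [[x _ ->]|BP].
  by rewrite pblock_mem // cP inE.
have /set0Pn[x xB] : B != set0 by apply: contraNneq nP => <-.
by exists x; rewrite ?inE // (def_pblock tP BP xB).
Qed.

Lemma card_kernel_partition (T U : finType) (f : T -> U) :
  #|kernel_partition f| = #|f @: [set: T]|.
Proof.
rewrite -{1}(imset_pblock (kernel_partitionP f)).
by apply: card_imset_same_kernel => x y; rewrite pblock_kernel_partition.
Qed.

(** Each point is labelled by the position of its block in [enum P], which is below [#|P|] and so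
    below [m]. *)
Lemma partition_labelling (T : finType) (m : nat) (P : {set {set T}}) :
  partition P [set: T] -> #|P| <= m ->
  exists f : T -> 'I_m, kernel_partition f = P.
Proof.
move=> pP Pm; have [/eqP cP tP nP] := and3P pP.
have inP x : pblock P x \in P by rewrite pblock_mem // cP inE.
have lt x : index (pblock P x) (enum P) < m.
  by rewrite (leq_trans _ Pm) // cardE index_mem mem_enum.
exists (fun x => Ordinal (lt x)).
rewrite -[RHS](equivalence_partition_pblock pP); apply: eq_imset => x.
apply/setP => y; rewrite !inE /= -eq_pblock ?cP ?inE //.
rewrite -val_eqE /=; apply/eqP/eqP => [|-> //].
by apply: (index_inj set0); rewrite mem_enum.
Qed.

(** For positive [m] the sizes [m.-1] and [m] differ, so the two families counted on the left are
    disjoint. *)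
Lemma stirling2_add (r m : nat) : 0 < m ->
  stirling2 r m + stirling2 r m.-1 =
  #|[set P : {set {set 'I_r}} |
      partition P [set: 'I_r] & m.-1 <= #|P| <= m]|.
Proof.
move=> m0; rewrite /stirling2 -cardsUI [X in _ + #|pred_of_set X|](_ : _ = set0).
  rewrite cards0 addn0; congr #|pred_of_set _|; apply/setP => P.
  by rewrite !inE; case: partition => //=; lia.
by apply/setP => P; rewrite !inE; case: partition => //=; lia.
Qed.

(** * Automorphisms of Hamming graphs *)

Lemma perm_same_kernel (T U : finType) (f g : T -> U) :
  (forall x y, (f x == f y) = (g x == g y)) ->
  exists s : {perm U}, forall x, s (f x) = g x.
Proof.
move=> fg.
suff H (l : seq T) : exists s : {perm U}, {in l, forall x, s (f x) = g x}.
  by have [s sE] := H (enum T); exists s => x; apply: sE; rewrite mem_enum.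
elim: l => [|x0 l [s IH]]; first by exists 1%g.
(* The transposition corrects the value at [f x0]. It leaves earlier values in place: it is trivial
   if [f x0] was already treated, and otherwise moves none of them. *)
exists (s * tperm (s (f x0)) (g x0))%g => x; rewrite inE permM.
case/predU1P=> [->|xl]; first by rewrite tpermL.
rewrite (IH x) //; have [E|ne] := eqVneq (f x) (f x0).
  move/eqP: (E); rewrite fg => /eqP gE.
  by rewrite -E IH // -gE tperm1 perm1.
rewrite tpermD // eq_sym; last by rewrite -fg.
by rewrite -IH // (inj_eq perm_inj).
Qed.

Section Hamming.
Variables m n : nat.
Local Notation H := (hamming_graph m n).

Definition hdist (x y : H) : nat := #|[set i | x i != y i]|.

Lemma hdist_triangle y x z : hdist x z <= hdist x y + hdist y z.
Proof.
apply: leq_trans (leq_card_setU _ _); apply/subset_leq_card/subsetP => i.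
by rewrite !inE -negb_and; apply: contra => /andP[/eqP -> /eqP ->].
Qed.

Lemma hdist0 x y : hdist x y = 0 -> x = y.
Proof.
move/eqP; rewrite cards_eq0 => /eqP/setP D; apply/ffunP => i.
by move: (D i); rewrite !inE => /negbFE/eqP.
Qed.

Lemma hdist1P (x y : H) :
  reflect (exists i, x i != y i /\ forall j, j != i -> x j = y j)
          (hdist x y == 1).
Proof.
apply: (iffP cards1P) => -[i]; last first.
  case=> xy D; exists i; apply/setP => j; rewrite !inE.
  by have [->|/D ->] := eqVneq j i; rewrite ?xy ?eqxx.
move/setP=> D; exists i; split=> [|j ji]; first by have := D i; rewrite !inE eqxx.
by have := D j; rewrite !inE (negbTE ji) => /negbFE/eqP.
Qed.

Lemma sedgeE (x y : H) : sedge x y = (hdist x y == 1).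
Proof.
apply/existsP/hdist1P => -[i] => [/andP[xy /forallP D]|[xy D]]; exists i.
  by split=> // j ji; apply/eqP; have := D j; rewrite ji.
by rewrite /= /complete_edge xy; apply/forallP => j; apply/implyP => /D ->.
Qed.

Definition update (x : H) i a : H := [ffun j => if j == i then a else x j].

Lemma automorphism_hdist_le (p : {perm H}) (x y : H) :
  automorphism p -> hdist (p x) (p y) <= hdist x y.
Proof.
move=> /forallP ap; have [d] := ubnP (hdist x y).
elim: d x => // d IH x; rewrite ltnS => xyd.
case: (posnP (hdist x y)) => [/hdist0 ->|].
  by rewrite /hdist; apply/eq_leq/eq_card => i; rewrite !inE !eqxx.
rewrite card_gt0 => /set0Pn[i]; rewrite inE => xy.
(* A neighbour of [x] one step nearer to [y]; edges are preserved, so the triangle inequality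
   through [p z] closes the induction. *)
pose z := update x i (y i).
have xz : hdist x z == 1.
  apply/hdist1P; exists i; rewrite /z ffunE eqxx; split=> // j ji.
  by rewrite ffunE (negbTE ji).
have zy : hdist x y = (hdist z y).+1.
  rewrite /hdist (cardsD1 i) inE xy add1n; congr _.+1; apply: eq_card => j.
  by rewrite !inE ffunE; case: eqVneq => [->|]; rewrite ?eqxx.
have pxz : hdist (p x) (p z) == 1.
  by rewrite -sedgeE; have /forallP/(_ z)/eqP -> := ap x; rewrite sedgeE.
apply: leq_trans (hdist_triangle (p z) _ _) _.
by rewrite (eqP pxz) zy add1n ltnS IH // -zy.
Qed.

Lemma automorphismV (p : {perm H}) : automorphism p -> automorphism p^-1%g.
Proof.
move=> /forallP ap; apply/forallP => x; apply/forallP => y.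
by have /forallP/(_ (p^-1%g y))/eqP := ap (p^-1%g x); rewrite !permKV => ->.
Qed.

Lemma automorphism_hdist (p : {perm H}) (x y : H) :
  automorphism p -> hdist (p x) (p y) = hdist x y.
Proof.
move=> ap; apply/eqP; rewrite eqn_leq automorphism_hdist_le //=.
have := automorphism_hdist_le (p x) (p y) (automorphismV ap).
by rewrite !permK.
Qed.

(** The two distances have equal contributions outside [i]. At [i] they contribute 0 and 1 when
    [z i = x i], while otherwise [x] contributes 1 and [y] at most 1. *)
Lemma closer_slice (x y : H) i :
  x i != y i -> (forall j, j != i -> x j = y j) ->
  forall z : H, (hdist z x < hdist z y) = (z i == x i).
Proof.
move=> xy D z; rewrite /hdist (cardsD1 i) [X in _ < X](cardsD1 i) !inE.
rewrite [X in _ < _ + X](_ : _ = #|[set j | z j != x j] :\ i|).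
  rewrite ltn_add2r; have [->|_] := eqVneq (z i) (x i); first by rewrite xy.
  by case: (z i != y i).
by apply: eq_card => j; rewrite !inE; case: eqVneq => //= /D ->.
Qed.

Lemma automorphism_coordinates (p : {perm H}) : 1 < m -> automorphism p ->
  forall i, exists j, exists g : 'I_m -> 'I_m,
    forall (z : H) a, (z i == a) = (p z j == g a).
Proof.
move=> m1 ap i.
have other (a : 'I_m) : exists b, b != a.
  have /card_gt0P[b] : 0 < #|[set~ a]| by rewrite cardsC1 card_ord; lia.
  by rewrite !inE => ba; exists b.
(* Each slice in direction [i] goes to a slice, but so far its direction [j] may depend on [a]. *)
have slice a : exists j a', forall z : H, (z i == a) = (p z j == a').
  have [b ba] := other a.
  pose x : H := [ffun=> a]; pose y := update x i b.
  have xi : x i = a by rewrite ffunE.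
  have xy : x i != y i by rewrite !ffunE eqxx eq_sym.
  have D j : j != i -> x j = y j by rewrite !ffunE => /negbTE ->.
  have : hdist (p x) (p y) == 1.
    by rewrite automorphism_hdist //; apply/hdist1P; exists i.
  case/hdist1P=> j [pxy pD]; exists j, (p x j) => z.
  by rewrite -{1}xi -(closer_slice xy D) -(closer_slice pxy pD)
             !automorphism_hdist.
have a0 : 'I_m := Ordinal (ltnW m1).
have [j [a0' s0]] := slice a0; exists j.
suff S a : exists a', forall z : H, (z i == a) = (p z j == a').
  by have [g gE] := fin_all_exists S; exists g => z a; apply: gE.
have [->|aa0] := eqVneq a a0; first by exists a0'.
have [k [a' sa]] := slice a; exists a' => z; rewrite sa.
(* The slices of a and a0 are disjoint, while slices in different directions
   always meet. *)
suff -> : k = j by [].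
apply/eqP; apply: contraNT aa0 => kj.
pose w := update (update z j a0') k a'.
have := s0 (p^-1%g w); have := sa (p^-1%g w).
rewrite !permKV !ffunE [j == k]eq_sym (negbTE kj) !eqxx.
by move=> /eqP <- /eqP ->.
Qed.

(** These maps form the wreath product of the symmetric groups on values and on coordinates. They
    supply the nontrivial automorphisms that show a set not to be determining. *)
Definition wreath_fun (c : 'I_n -> {perm 'I_m}) (t : {perm 'I_n}) (x : H) : H :=
  [ffun i => c i (x (t i))].

Lemma hdist_wreath c t x y :
  hdist (wreath_fun c t x) (wreath_fun c t y) = hdist x y.
Proof.
rewrite /hdist -[RHS](card_preimset _ (@perm_inj _ t)); apply: eq_card => i.
by rewrite !inE !ffunE (inj_eq perm_inj).
Qed.

Lemma wreath_inj c t : injective (wreath_fun c t).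
Proof.
move=> x y E; apply: hdist0; rewrite -(hdist_wreath c t) E.
by apply: eq_card0 => i; rewrite !inE eqxx.
Qed.

Definition wreath c t : {perm H} := perm (@wreath_inj c t).

Lemma wreath_automorphism c t : automorphism (wreath c t).
Proof.
apply/forallP => x; apply/forallP => y.
by rewrite !sedgeE !permE hdist_wreath.
Qed.

(** * Determining sets as arrays *)

Section Columns.
Variables (r : nat) (v : 'I_r -> H).
Hypothesis m1 : 1 < m.

(** Rows of the array may repeat, so the set that they form has at most [r] vertices. *)
Definition column (i : 'I_n) (k : 'I_r) : 'I_m := v k i.

Lemma determining_fixP : reflect
  (forall p : {perm H}, automorphism p -> (forall k, p (v k) = v k) -> p = 1%g)
  (determining (v @: [set: 'I_r])).
Proof.
apply: (iffP forallP) => D p.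
  move=> ap fp; apply/eqP; have := D p; rewrite ap /= => /implyP; apply.
  by apply/forall_inP => _ /imsetP[k _ ->]; rewrite fp.
apply/implyP => ap; apply/implyP => /forall_inP fp; apply/eqP/D => // k.
by apply/eqP/fp/imset_f.
Qed.

Lemma determining_card_column i :
  determining (v @: [set: 'I_r]) -> m.-1 <= #|column i @: [set: 'I_r]|.
Proof.
move/determining_fixP=> D; rewrite leqNgt; apply/negP => lt.
have : 1 < #|~: (column i @: [set: 'I_r])|.
  have := cardsC (column i @: [set: 'I_r]); rewrite card_ord; lia.
case/card_gt1P=> a [b [aN bN ab]].
pose c l := if l == i then tperm a b else 1%g.
have E : wreath c 1%g = 1%g.
  apply: D => [|k]; first exact: wreath_automorphism.
  apply/ffunP => l; rewrite permE ffunE perm1 /c.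
  case: eqVneq => [->|_]; last by rewrite perm1.
  have kI : column i k \in column i @: [set: 'I_r] by apply: imset_f.
  by apply: tpermD; [apply: contraTneq aN|apply: contraTneq bN] => ->;
    rewrite inE negbK.
(* The constant vertex [a] is moved: its coordinate [i] becomes [b]. *)
have := congr1 (fun p : {perm H} => p [ffun=> a] i) E.
by rewrite /= permE perm1 !ffunE /c eqxx tpermL => /esym/eqP; rewrite (negbTE ab).
Qed.

Lemma determining_column_inj :
  determining (v @: [set: 'I_r]) ->
  injective (fun i => kernel_partition (column i)).
Proof.
move/determining_fixP=> D i j /= Kij; apply/eqP; apply: contraT => ij.
have ker k l : (column i k == column i l) = (column j k == column j l).
  by rewrite -(pblock_kernel_partition (column i)) Kij pblock_kernel_partition.
have [s sE] := perm_same_kernel ker.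
(* Since [s] turns column [i] into column [j], exchanging the two coordinates with these
   relabellings fixes every row. *)
pose c l := if l == j then s else if l == i then s^-1%g else 1%g.
have E : wreath c (tperm i j) = 1%g.
  apply: D => [|k]; first exact: wreath_automorphism.
  apply/ffunP => l; rewrite permE ffunE /c.
  have [->|lj] := eqVneq l j; first by rewrite tpermR; apply: sE.
  have [->|li] := eqVneq l i; first by rewrite tpermL -[v k j]sE permK.
  by rewrite perm1 tpermD // eq_sym.
pose a : 'I_m := Ordinal (ltnW m1); pose b : 'I_m := Ordinal m1.
have at_j (x : H) : x j = s (x i).
  by rewrite -[in LHS](perm1 x) -E permE ffunE tpermR /c eqxx.
(* These two vertices agree at [i] but differ at [j], so coordinate [j] cannot be a function of
   coordinate [i]. *)
have := at_j (update [ffun=> a] j b); have := at_j [ffun=> a].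
by rewrite !ffunE eqxx (negbTE ij) => <-.
Qed.

(** If [p] fixes all rows, its relabelling [g] turns column [i] into a column [j] with the same
    level sets, so [j = i]. Then [g] is injective and fixes all values but at most one, hence all of
    them. *)
Lemma columns_determining :
  injective (fun i => kernel_partition (column i)) ->
  (forall i, m.-1 <= #|column i @: [set: 'I_r]|) ->
  determining (v @: [set: 'I_r]).
Proof.
move=> Kinj Im; apply/determining_fixP => p ap fp; apply/permP => x.
rewrite perm1; apply/ffunP => i.
have [j [g gE]] := automorphism_coordinates m1 ap i.
have pE (z : H) : p z j = g (z i) by apply/eqP; rewrite -gE.
have ij : i = j.
  apply: Kinj; apply: eq_imset => k; apply/setP => l; rewrite !inE.
  by rewrite /= /column gE -pE !fp.
subst j; rewrite pE.
have ginj : injective g.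
  move=> a b ab; have := gE [ffun=> a] b.
  by rewrite pE ffunE ab eqxx => /eqP.
have gfix a : a \in column i @: [set: 'I_r] -> g a = a.
  by case/imsetP=> k _ ->; rewrite /column -pE fp.
apply/eqP; apply: contraT => ne.
(* Otherwise both [x i] and [g (x i)] are missing from the column. *)
have N1 : x i \notin column i @: [set: 'I_r].
  by apply: contra ne => /gfix ->.
have N2 : g (x i) \notin column i @: [set: 'I_r].
  by apply: contra ne => /gfix/ginj ->.
have : 1 < #|~: (column i @: [set: 'I_r])|.
  by apply/card_gt1P; exists (g (x i)), (x i); rewrite !inE.
have := cardsC (column i @: [set: 'I_r]); rewrite card_ord.
by move: (Im i); lia.
Qed.

End Columns.
End Hamming.

Theorem theorem4p1 (m n : nat) (hm : 2 <= m) (hn : 1 <= n) :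
  n <= stirling2 (determining_number (hamming_graph m n)) m
       + stirling2 (determining_number (hamming_graph m n)) m.-1 /\
  (forall r : nat, n <= stirling2 r m + stirling2 r m.-1 ->
     determining_number (hamming_graph m n) <= r).
Proof.
have [[S dS <-] detle] := determining_numberP (hamming_graph m n).
split=> [|r]; rewrite stirling2_add ?(ltnW hm) //.
  (* List a minimum determining set as rows: its [n] column partitions are distinct members of the
     counted family. *)
  pose v (k : 'I_#|S|) : hamming_graph m n := enum_val k.
  have vS : v @: [set: 'I_#|S|] = S.
    apply/setP => x; apply/imsetP/idP => [[k _ ->]|xS]; first exact: enum_valP.
    by exists (enum_rank_in xS x); rewrite // /v enum_rankK_in.
  rewrite -vS in dS.
  rewrite -[n in n <= _]card_ord -cardsT.
  rewrite -(card_imset _ (determining_column_inj hm dS)).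
  apply/subset_leq_card/subsetP => _ /imsetP[i _ ->].
  rewrite inE kernel_partitionP card_kernel_partition determining_card_column //=.
  by rewrite -[X in _ <= X]card_ord max_card.
set PP := [set P | _] => nPP.
(* Conversely, choose [n] distinct partitions from the family; labellings of their blocks become the
   columns of an array with [r] rows. *)
pose P (i : 'I_n) := enum_val (widen_ord nPP i).
have PPi i : P i \in PP by apply: enum_valP.
have lab i : exists f : {ffun 'I_r -> 'I_m}, kernel_partition f = P i.
  have := PPi i; rewrite inE => /and3P[pP _ Pm].
  have [f fP] := partition_labelling pP Pm; exists (finfun f).
  by rewrite -fP; apply: eq_imset => k; apply/setP => l; rewrite !inE /= !ffunE.
have [f fP] := fin_all_exists lab.
pose v (k : 'I_r) : hamming_graph m n := [ffun i => f i k].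
have colP i : kernel_partition (column v i) = P i.
  rewrite -fP; apply: eq_imset => k; apply/setP => l.
  by rewrite !inE /column /= !ffunE.
apply: leq_trans (detle (v @: [set: 'I_r]) _) _; last first.
  by rewrite (leq_trans (leq_imset_card _ _)) // cardsT card_ord.
apply: columns_determining => // [i j|i].
  by rewrite !colP => /enum_val_inj/(congr1 val)/= ?; apply: val_inj.
by rewrite -card_kernel_partition colP; have := PPi i; rewrite inE => /and3P[].
Qed.
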